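(* Let $\alpha\in(0,2\pi)$ and $\rho\in\mathbb C$, and let $$S=\begin{pmatrix}\cos\frac{\alpha}{2} & ie^{\rho/2}\sin\frac{\alpha}{2}\\ ie^{-\rho/2}\sin\frac{\alpha}{2} & \cos\frac{\alpha}{2}\end{pmatrix},\qquad T=\begin{pmatrix}\cos\frac{\alpha}{2} & ie^{-\rho/2}\sin\frac{\alpha}{2}\\ ie^{\rho/2}\sin\frac{\alpha}{2} & \cos\frac{\alpha}{2}\end{pmatrix}.$$ Put $A=\cot\frac{\alpha}{2}$, $V=\cosh\rho$ and $W=S^{-1}(STS^{-1}T^{-1})^2(ST^{-1}S^{-1}T)^2$. If $P(V,A)=0$, where $$P(V,A)=8V^5+8A^2V^4+(8A^4+16A^2-8)V^3+(4A^6+8A^4-12A^2)V^2+(A^8+4A^6-2A^4-12A^2+1)V-4A^6-8A^4+4A^2,$$ then $SWS^{-1}W^{-1}=I$, i.e. $s\mapsto S$, $t\mapsto T$ defines a representation $h$ of $\pi_1(X)=\langle s,t\mid sws^{-1}w^{-1}=1\rangle$, $w=s^{-1}[s,t]^2[s,t^{-1}]^2$, into $\mathrm{SL}(2,\mathbb C)$.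
   Context: $X$ is the complement of the link $7_3^2$ (slope $9/16$ version), with fundamental group $\pi_1(X)=\langle s,t\mid sws^{-1}w^{-1}=1\rangle$, $w=s^{-1}[s,t]^2[s,t^{-1}]^2$, and commutator convention $[a,b]=aba^{-1}b^{-1}$. The polynomial $P$ is called the Riley–Mednykh polynomial of the link $7_3^2$. *)

(* Defs.v *)
From Stdlib Require Import Reals.
Open Scope R_scope.

Record Cplx := mkC { Re : R ; Im : R }.

Definition RtoC (x : R) : Cplx := mkC x 0.
Definition C0 : Cplx := RtoC 0.
Definition C1 : Cplx := RtoC 1.
Definition Ci : Cplx := mkC 0 1.
Definition Cadd (z w : Cplx) : Cplx := mkC (Re z + Re w) (Im z + Im w).
Definition Copp (z : Cplx) : Cplx := mkC (- Re z) (- Im z).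
Definition Csub (z w : Cplx) : Cplx := Cadd z (Copp w).
Definition Cmul (z w : Cplx) : Cplx :=
  mkC (Re z * Re w - Im z * Im w) (Re z * Im w + Im z * Re w).
Definition Cinv (z : Cplx) : Cplx :=
  let n := Re z * Re z + Im z * Im z in mkC (Re z / n) (- Im z / n).
Fixpoint Cpow (z : Cplx) (n : nat) : Cplx :=
  match n with O => C1 | S k => Cmul z (Cpow z k) end.

Definition Cexp (z : Cplx) : Cplx := mkC (exp (Re z) * cos (Im z)) (exp (Re z) * sin (Im z)).
Definition Ccosh (z : Cplx) : Cplx := Cmul (RtoC (/2)) (Cadd (Cexp z) (Cexp (Copp z))).

Record Mat2 := mkM { m11 : Cplx ; m12 : Cplx ; m21 : Cplx ; m22 : Cplx }.
Definition MI : Mat2 := mkM C1 C0 C0 C1.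
Definition Mmul (X Y : Mat2) : Mat2 :=
  mkM (Cadd (Cmul (m11 X) (m11 Y)) (Cmul (m12 X) (m21 Y)))
      (Cadd (Cmul (m11 X) (m12 Y)) (Cmul (m12 X) (m22 Y)))
      (Cadd (Cmul (m21 X) (m11 Y)) (Cmul (m22 X) (m21 Y)))
      (Cadd (Cmul (m21 X) (m12 Y)) (Cmul (m22 X) (m22 Y))).
Definition Mdet (X : Mat2) : Cplx := Csub (Cmul (m11 X) (m22 X)) (Cmul (m12 X) (m21 X)).
Definition Minv (X : Mat2) : Mat2 :=
  let k := Cinv (Mdet X) in
  mkM (Cmul k (m22 X)) (Cmul k (Copp (m12 X))) (Cmul k (Copp (m21 X))) (Cmul k (m11 X)).

Definition Smat (alpha : R) (rho : Cplx) : Mat2 :=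
  let c := RtoC (cos (alpha / 2)) in
  let s := RtoC (sin (alpha / 2)) in
  let h := Cmul (RtoC (/2)) rho in
  mkM c (Cmul Ci (Cmul (Cexp h) s)) (Cmul Ci (Cmul (Cexp (Copp h)) s)) c.
Definition Tmat (alpha : R) (rho : Cplx) : Mat2 :=
  let c := RtoC (cos (alpha / 2)) in
  let s := RtoC (sin (alpha / 2)) in
  let h := Cmul (RtoC (/2)) rho in
  mkM c (Cmul Ci (Cmul (Cexp (Copp h)) s)) (Cmul Ci (Cmul (Cexp h) s)) c.

Definition Wmat (S T : Mat2) : Mat2 :=
  let Si := Minv S in let Ti := Minv T in
  let c1 := Mmul S (Mmul T (Mmul Si Ti)) in
  let c2 := Mmul S (Mmul Ti (Mmul Si T)) in
  Mmul Si (Mmul (Mmul c1 c1) (Mmul c2 c2)).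

(** Riley–Mednykh polynomial P(V,A) of the link 7_3^2, V complex, A real. *)
Definition RMpoly (V : Cplx) (A : R) : Cplx :=
  let a := RtoC A in
  let cst (x : R) := RtoC x in
  Cadd (Cmul (cst 8) (Cpow V 5))
  (Cadd (Cmul (Cmul (cst 8) (Cpow a 2)) (Cpow V 4))
  (Cadd (Cmul (Cadd (Cadd (Cmul (cst 8) (Cpow a 4)) (Cmul (cst 16) (Cpow a 2))) (cst (-8))) (Cpow V 3))
  (Cadd (Cmul (Cadd (Cadd (Cmul (cst 4) (Cpow a 6)) (Cmul (cst 8) (Cpow a 4))) (Cmul (cst (-12)) (Cpow a 2))) (Cpow V 2))
  (Cadd (Cmul (Cadd (Cadd (Cadd (Cadd (Cpow a 8) (Cmul (cst 4) (Cpow a 6))) (Cmul (cst (-2)) (Cpow a 4)))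
                        (Cmul (cst (-12)) (Cpow a 2))) (cst 1)) V)
  (Cadd (Cmul (cst (-4)) (Cpow a 6)) (Cadd (Cmul (cst (-8)) (Cpow a 4)) (Cmul (cst 4) (Cpow a 2)))))))).

(* Main.v *)
Require Import Defs.
From Stdlib Require Import Reals.
From Stdlib Require Import ZArith Ring Lra.
(* [Reals] shadows the [C1] of [Defs]. *)
Import Defs.
Open Scope R_scope.

(** Let [X, Y] in SL(2) have traces [x, y], and put [z = tr XY],
    [u = tr XY^-1 = xy - z] and [t = tr [X,Y] = tr [X,Y^-1]].  By
    Cayley–Hamilton, squares of commutators are linear in the commutators, so
    [W = X^-1 [X,Y]^2 [X,Y^-1]^2] is a linear combination of [X^-1] and of the
    palindromes [Y X^-1 Y^-1 X Y^-1 X^-1 Y] and [Y X^-1 Y^-1 + Y^-1 X^-1 Y].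
    The identity [Z N Z = tr(ZN) Z - N^-1] in SL(2) writes every palindrome in
    the span of [1, X, Y].  Hence [XW - WX] is a scalar multiple of [XY - YX],
    and the scalar is [t (z (t - 1) + u (1 + t - t^2))].  For the matrices [S]
    and [T] its second factor is [- 4 sin(alpha/2)^10 P(V, A)]. *)

Declare Scope Cplx_scope.
Delimit Scope Cplx_scope with Cx.
Bind Scope Cplx_scope with Cplx.
Local Infix "+" := Cadd : Cplx_scope.
Local Infix "-" := Csub : Cplx_scope.
Local Infix "*" := Cmul : Cplx_scope.
Local Infix "^" := Cpow : Cplx_scope.
Local Notation "- z" := (Copp z) : Cplx_scope.
Local Notation "# x" := (RtoC x%R) (at level 1, format "# x") : Cplx_scope.

Lemma Cplx_ext (z w : Cplx) : Re z = Re w -> Im z = Im w -> z = w.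
Proof. destruct z, w; simpl; intros -> ->; reflexivity. Qed.

Lemma Cplx_ring_theory : ring_theory C0 C1 Cadd Cmul Csub Copp eq.
Proof.
  constructor; intros; try reflexivity; apply Cplx_ext; simpl; ring.
Qed.

Lemma RtoC_IZR_morph :
  ring_morph C0 C1 Cadd Cmul Csub Copp eq
    0%Z 1%Z Z.add Z.mul Z.sub Z.opp Z.eqb (fun n => RtoC (IZR n)).
Proof.
  constructor; try reflexivity; intros m n || intros m.
  - apply Cplx_ext; simpl; rewrite ?plus_IZR; ring.
  - apply Cplx_ext; simpl; rewrite ?minus_IZR; ring.
  - apply Cplx_ext; simpl; rewrite ?mult_IZR; ring.
  - apply Cplx_ext; simpl; rewrite ?opp_IZR; ring.
  - intros eq_mn; apply Z.eqb_eq in eq_mn; subst; reflexivity.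
Qed.

Lemma Cpow_power_theory : power_theory C1 Cmul eq N.to_nat Cpow.
Proof.
  constructor; intros z n; destruct n as [|n]; [reflexivity|]; simpl.
  induction n as [|n IHn] using Pos.peano_ind.
  - apply Cplx_ext; simpl; ring.
  - rewrite Pos2Nat.inj_succ, pow_pos_succ; simpl.
    + now rewrite IHn.
    + repeat constructor; congruence.
    + now intros ? ? -> ? ? ->.
    + apply (Rmul_assoc Cplx_ring_theory).
Qed.

Ltac Cplx_cst t :=
  match t with
  | C0 => constr:(0%Z)
  | C1 => constr:(1%Z)
  | RtoC (IZR ?n) =>
      match isZcst n with true => n | _ => constr:(NotConstant) end
  | _ => constr:(NotConstant)
  end.

Ltac Cpow_cst t :=
  match isnatcst t with
  | true => constr:(N.of_nat t)
  | _ => constr:(InitialRing.NotConstant)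
  end.

Add Ring Cplx_ring : Cplx_ring_theory
  (morphism RtoC_IZR_morph, constants [Cplx_cst],
   power_tac Cpow_power_theory [Cpow_cst]).

Local Open Scope Cplx_scope.

Lemma Csub_eq0 (z w : Cplx) : z - w = C0 -> z = w.
Proof.
  intros sub_eq0; transitivity (z - w + w); [|rewrite sub_eq0]; ring.
Qed.

Lemma Cinv_1 : Cinv C1 = C1.
Proof. apply Cplx_ext; simpl; field. Qed.

Lemma Ci_sqr : Ci ^ 2 = #(-1).
Proof. apply Cplx_ext; simpl; ring. Qed.

Lemma Cexp_add (z w : Cplx) : Cexp (z + w) = Cexp z * Cexp w.
Proof.
  apply Cplx_ext; simpl; rewrite exp_plus, ?cos_plus, ?sin_plus; ring.
Qed.

Lemma Cexp_mul_opp (z : Cplx) : Cexp z * Cexp (- z) = C1.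
Proof.
  rewrite <- Cexp_add; apply Cplx_ext; simpl;
    rewrite !Rplus_opp_r, exp_0, ?cos_0, ?sin_0; ring.
Qed.

Lemma Ccosh_half (z : Cplx) :
  #2 * Ccosh z = Cexp (#(/2) * z) ^ 2 + Cexp (- (#(/2) * z)) ^ 2.
Proof.
  set (h := #(/2) * z).
  assert (z_double : z = h + h) by (apply Cplx_ext; simpl; field).
  unfold Ccosh; rewrite z_double.
  replace (- (h + h)) with (- h + - h) by ring.
  rewrite !Cexp_add; apply Cplx_ext; simpl; field.
Qed.

Lemma RtoC_cos2_sin2 (a : R) : #(cos a) ^ 2 + #(sin a) ^ 2 = C1.
Proof.
  apply Cplx_ext; simpl; [|ring].
  pose proof (sin2_cos2 a) as sin2_cos2_a; unfold Rsqr in sin2_cos2_a; lra.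
Qed.

Definition M0 : Mat2 := mkM C0 C0 C0 C0.

Definition Madd (X Y : Mat2) : Mat2 :=
  mkM (m11 X + m11 Y) (m12 X + m12 Y) (m21 X + m21 Y) (m22 X + m22 Y).

Definition Msub (X Y : Mat2) : Mat2 :=
  mkM (m11 X - m11 Y) (m12 X - m12 Y) (m21 X - m21 Y) (m22 X - m22 Y).

Definition Mscal (k : Cplx) (X : Mat2) : Mat2 :=
  mkM (k * m11 X) (k * m12 X) (k * m21 X) (k * m22 X).

Definition Mtr (X : Mat2) : Cplx := m11 X + m22 X.

Definition Madj (X : Mat2) : Mat2 := mkM (m22 X) (- m12 X) (- m21 X) (m11 X).

Definition Mcommutator (X Y : Mat2) : Mat2 :=
  Mmul X (Mmul Y (Mmul (Minv X) (Minv Y))).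

Definition Mbracket (X Y : Mat2) : Mat2 := Msub (Mmul X Y) (Mmul Y X).

Declare Scope Mat2_scope.
Delimit Scope Mat2_scope with M.
Bind Scope Mat2_scope with Mat2.
Local Infix "+" := Madd : Mat2_scope.
Local Infix "-" := Msub : Mat2_scope.
Local Infix "*" := Mmul : Mat2_scope.
Local Infix "*:" := Mscal (at level 40) : Mat2_scope.
Local Notation "X ^*" := (Madj X) (at level 2, format "X ^*") : Mat2_scope.

Lemma Mat2_ext (X Y : Mat2) :
  m11 X = m11 Y -> m12 X = m12 Y -> m21 X = m21 Y -> m22 X = m22 Y -> X = Y.
Proof. destruct X, Y; simpl; intros -> -> -> ->; reflexivity. Qed.

Ltac Mat2_ring := apply Mat2_ext; cbn; ring.

Lemma Mmul_assoc (X Y Z : Mat2) : (X * (Y * Z) = X * Y * Z)%M.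
Proof. Mat2_ring. Qed.

Lemma Mmul_1l (X : Mat2) : (MI * X = X)%M.
Proof. Mat2_ring. Qed.

Lemma Msub_eq0 (X Y : Mat2) : (X - Y = M0)%M -> X = Y.
Proof.
  intros sub_eq0; apply Mat2_ext; apply Csub_eq0.
  - exact (f_equal m11 sub_eq0).
  - exact (f_equal m12 sub_eq0).
  - exact (f_equal m21 sub_eq0).
  - exact (f_equal m22 sub_eq0).
Qed.

Lemma Mdet_mul (X Y : Mat2) : Mdet (X * Y) = Mdet X * Mdet Y.
Proof. unfold Mdet; cbn; ring. Qed.

Lemma Mdet_adj (X : Mat2) : Mdet X^* = Mdet X.
Proof. unfold Mdet; cbn; ring. Qed.

Lemma Madj_involutive (X : Mat2) : (X^*^* = X)%M.
Proof. Mat2_ring. Qed.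

Lemma Madj_mul (X Y : Mat2) : ((X * Y)^* = Y^* * X^*)%M.
Proof. Mat2_ring. Qed.

Lemma Mmul_adjr (X : Mat2) : (X * X^* = Mdet X *: MI)%M.
Proof. unfold Mdet; Mat2_ring. Qed.

Lemma Mmul_adjl (X : Mat2) : (X^* * X = Mdet X *: MI)%M.
Proof. unfold Mdet; Mat2_ring. Qed.

Lemma Mtr_adj (X : Mat2) : Mtr X^* = Mtr X.
Proof. unfold Mtr; cbn; ring. Qed.

Lemma Mtr_mulC (X Y : Mat2) : Mtr (X * Y) = Mtr (Y * X).
Proof. unfold Mtr; cbn; ring. Qed.

Lemma Mtr_mul_adjr (X Y : Mat2) : Mtr (X * Y^*) = Mtr X * Mtr Y - Mtr (X * Y).
Proof. unfold Mtr; cbn; ring. Qed.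

Lemma Mtr_mul_adj (X Y : Mat2) : Mtr (X^* * Y^*) = Mtr (X * Y).
Proof. unfold Mtr; cbn; ring. Qed.

Lemma Mtr_sqr (X : Mat2) : Mtr (X * X) = Mtr X ^ 2 - #2 * Mdet X.
Proof. unfold Mtr, Mdet; cbn; ring. Qed.

Lemma Cayley_Hamilton (X : Mat2) : (X * X = Mtr X *: X - Mdet X *: MI)%M.
Proof. unfold Mtr, Mdet; Mat2_ring. Qed.

Lemma Mmul_sandwich (Z N : Mat2) :
  (Z * N * Z = Mtr (Z * N) *: Z - Mdet Z *: N^*)%M.
Proof. unfold Mtr, Mdet; Mat2_ring. Qed.

Lemma Mmul_sandwich_polarized (Y Z N : Mat2) :
  (Y * N * Z + Z * N * Y
   = Mtr (Y * N) *: Z + Mtr (Z * N) *: Y - Mtr (Y * Z^*) *: N^*)%M.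
Proof. unfold Mtr; Mat2_ring. Qed.

Lemma Mtr_mul_sandwich (K Z N : Mat2) :
  Mtr (K * (Z * N * Z)) = Mtr (Z * N) * Mtr (K * Z) - Mdet Z * Mtr (K * N^*).
Proof. rewrite Mmul_sandwich; unfold Mtr; cbn; ring. Qed.

Lemma Mbracket_self (X : Mat2) : Mbracket X X = M0.
Proof. Mat2_ring. Qed.

Lemma Mbracket_adjr (X Y : Mat2) : (Mbracket X Y^* = (- C1) *: Mbracket X Y)%M.
Proof. Mat2_ring. Qed.

Lemma Mbracket_addr (X Y Z : Mat2) :
  (Mbracket X (Y + Z) = Mbracket X Y + Mbracket X Z)%M.
Proof. Mat2_ring. Qed.

Lemma Mbracket_subr (X Y Z : Mat2) :
  (Mbracket X (Y - Z) = Mbracket X Y - Mbracket X Z)%M.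
Proof. Mat2_ring. Qed.

Lemma Mbracket_scalr (k : Cplx) (X Y : Mat2) :
  (Mbracket X (k *: Y) = k *: Mbracket X Y)%M.
Proof. Mat2_ring. Qed.

Lemma Mbracket_sandwich (X Z N : Mat2) :
  (Mbracket X (Z * N * Z)
   = Mtr (Z * N) *: Mbracket X Z + Mdet Z *: Mbracket X N)%M.
Proof.
  rewrite Mmul_sandwich, Mbracket_subr, !Mbracket_scalr, Mbracket_adjr.
  Mat2_ring.
Qed.

Lemma Minv_adj (X : Mat2) : Mdet X = C1 -> Minv X = Madj X.
Proof. intros detX; unfold Minv; rewrite detX, Cinv_1; Mat2_ring. Qed.

Lemma Mdet_inv (X : Mat2) : Mdet X = C1 -> Mdet (Minv X) = C1.
Proof. intros detX; now rewrite Minv_adj, Mdet_adj. Qed.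

Lemma Minv_involutive (X : Mat2) : Mdet X = C1 -> Minv (Minv X) = X.
Proof.
  intros detX; rewrite (Minv_adj (Minv X)) by now apply Mdet_inv.
  now rewrite Minv_adj, Madj_involutive.
Qed.

Lemma Mmul_invr (X : Mat2) : Mdet X = C1 -> (X * Minv X = MI)%M.
Proof. intros detX; rewrite Minv_adj, Mmul_adjr, detX by easy; Mat2_ring. Qed.

Lemma Mmul_adjK (X Y : Mat2) : Mdet X = C1 -> (X^* * (X * Y) = Y)%M.
Proof. intros detX; rewrite Mmul_assoc, Mmul_adjl, detX; Mat2_ring. Qed.

Lemma Mcommutator_adj (X Y : Mat2) :
  Mdet X = C1 -> Mdet Y = C1 -> (Mcommutator X Y = X * (Y * X^* * Y^*))%M.
Proof.
  intros detX detY; unfold Mcommutator.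
  now rewrite !Minv_adj, (Mmul_assoc Y).
Qed.

Lemma Mdet_commutator (X Y : Mat2) :
  Mdet X = C1 -> Mdet Y = C1 -> Mdet (Mcommutator X Y) = C1.
Proof.
  intros detX detY; unfold Mcommutator.
  rewrite !Mdet_mul, !Mdet_inv, detX, detY by easy; ring.
Qed.

Lemma Mcommutator_sqr (X Y : Mat2) :
  Mdet X = C1 -> Mdet Y = C1 ->
  (Mcommutator X Y * Mcommutator X Y
   = Mtr (Mcommutator X Y) *: Mcommutator X Y - MI)%M.
Proof.
  intros detX detY; rewrite Cayley_Hamilton, Mdet_commutator by easy.
  Mat2_ring.
Qed.

Lemma Mcommutator_eq1 (X Y : Mat2) :
  Mdet X = C1 -> Mdet Y = C1 -> Mbracket X Y = M0 -> Mcommutator X Y = MI.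
Proof.
  intros detX detY bracket0; unfold Mcommutator.
  rewrite Mmul_assoc, (Msub_eq0 _ _ bracket0), <- Mmul_assoc, (Mmul_assoc X).
  now rewrite (Mmul_invr X), Mmul_1l, Mmul_invr.
Qed.

Definition fricke (x y z : Cplx) : Cplx :=
  x ^ 2 + y ^ 2 + z ^ 2 - x * y * z - #2.

Lemma Mtr_commutator (X Y : Mat2) :
  Mdet X = C1 -> Mdet Y = C1 ->
  Mtr (Mcommutator X Y) = fricke (Mtr X) (Mtr Y) (Mtr (X * Y)).
Proof.
  intros detX detY; rewrite Mcommutator_adj by easy.
  transitivity (Mdet Y * Mtr X ^ 2 + Mdet X * Mtr Y ^ 2 + Mtr (X * Y) ^ 2
                - Mtr X * Mtr Y * Mtr (X * Y) - #2 * Mdet X * Mdet Y).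
  - unfold Mtr, Mdet; cbn; ring.
  - rewrite detX, detY; unfold fricke; ring.
Qed.

Lemma Mtr_commutator_invr (X Y : Mat2) :
  Mdet X = C1 -> Mdet Y = C1 ->
  Mtr (Mcommutator X (Minv Y)) = Mtr (Mcommutator X Y).
Proof.
  intros detX detY; rewrite !Mtr_commutator by auto using Mdet_inv.
  rewrite Minv_adj, Mtr_adj, Mtr_mul_adjr by easy; unfold fricke; ring.
Qed.

Section CommutatorWord.

Variables X Y : Mat2.
Hypotheses (detX : Mdet X = C1) (detY : Mdet Y = C1).

Local Notation x := (Mtr X).
Local Notation y := (Mtr Y).
Local Notation z := (Mtr (X * Y)).
Local Notation u := (x * y - z).
Local Notation t := (fricke x y z).

Lemma Wmat_commutators :
  Wmat X Y =
  (Minv X * (Mcommutator X Y * Mcommutator X Y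
             * (Mcommutator X (Minv Y) * Mcommutator X (Minv Y))))%M.
Proof. unfold Wmat, Mcommutator; now rewrite (Minv_involutive Y). Qed.

Lemma Mdet_Wmat : Mdet (Wmat X Y) = C1.
Proof.
  rewrite Wmat_commutators, !Mdet_mul, !Mdet_commutator, Mdet_inv
    by auto using Mdet_inv.
  ring.
Qed.

Lemma Wmat_palindromes :
  (Wmat X Y =
   t ^ 2 *: (Y * (X^* * (Y^* * X * Y^*) * X^*) * Y)
   - t *: (Y * X^* * Y^* + Y^* * X^* * Y) + X^*)%M.
Proof.
  set (A := Mcommutator X Y); set (B := Mcommutator X (Minv Y)).
  assert (sqr_A : (A * A = t *: A - MI)%M)
    by (unfold A; now rewrite Mcommutator_sqr, Mtr_commutator).
  assert (sqr_B : (B * B = t *: B - MI)%M).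
  { unfold B.
    rewrite Mcommutator_sqr, Mtr_commutator_invr by auto using Mdet_inv.
    now rewrite Mtr_commutator. }
  assert (A_eq : (A = X * (Y * X^* * Y^*))%M) by now apply Mcommutator_adj.
  assert (B_eq : (B = X * (Y^* * X^* * Y))%M).
  { unfold B; rewrite Mcommutator_adj, Minv_adj by auto using Mdet_inv.
    now rewrite Madj_involutive. }
  assert (linear_in_A_B :
    (Wmat X Y = t ^ 2 *: (X^* * A * B) - t *: (X^* * A + X^* * B) + X^*)%M).
  { rewrite Wmat_commutators, Minv_adj by easy; fold A B.
    rewrite sqr_A, sqr_B; Mat2_ring. }
  rewrite linear_in_A_B, A_eq, !Mmul_adjK, B_eq, Mmul_adjK by easy.
  now rewrite <- !Mmul_assoc.
Qed.

Lemma Mtr_palindrome :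
  Mtr (Y * (X^* * (Y^* * X * Y^*) * X^*)) = u * (#2 - t) + z.
Proof.
  assert (tr_XYadj : Mtr (X * Y^*) = u) by apply Mtr_mul_adjr.
  assert (tr_YXadj : Mtr (Y * X^*) = u)
    by (rewrite Mtr_mul_adjr, (Mtr_mulC Y X); ring).
  assert (tr_inner : Mtr (X^* * (Y^* * X * Y^*)) = u * z - x ^ 2 + #2).
  { rewrite Mtr_mul_sandwich, !Mtr_mul_adj, Mtr_mulC, Mdet_adj, tr_XYadj.
    rewrite Mtr_sqr, detX, detY; ring. }
  assert (tr_outer : Mtr (Y * (Y^* * X * Y^*)^*) = u * (y ^ 2 - #2) - z).
  { rewrite !Madj_mul, Madj_involutive, (Mmul_assoc Y (X^*)%M).
    rewrite Mtr_mul_sandwich, Madj_involutive, tr_YXadj.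
    rewrite Mtr_sqr, (Mtr_mulC Y X), detY; ring. }
  rewrite Mtr_mul_sandwich, tr_inner, tr_outer, tr_YXadj, Mdet_adj, detX.
  unfold fricke; ring.
Qed.

Lemma Mbracket_palindrome :
  (Mbracket X (Y * (X^* * (Y^* * X * Y^*) * X^*) * Y)
   = (u * (C1 - t) + z) *: Mbracket X Y)%M.
Proof.
  rewrite !Mbracket_sandwich, Mtr_palindrome, !Mbracket_adjr, Mbracket_self.
  rewrite !Mdet_adj, detX, detY, (Mtr_mulC _ X), Mtr_mul_adjr; Mat2_ring.
Qed.

Lemma Mbracket_palindrome_sum :
  (Mbracket X (Y * X^* * Y^* + Y^* * X^* * Y) = (z - u) *: Mbracket X Y)%M.
Proof.
  rewrite Mmul_sandwich_polarized, Madj_involutive, Mtr_mul_adj.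
  rewrite Mbracket_subr, Mbracket_addr, !Mbracket_scalr, Madj_involutive.
  rewrite Mbracket_adjr, Mbracket_self, Mtr_mul_adjr, (Mtr_mulC Y X).
  Mat2_ring.
Qed.

End CommutatorWord.

Definition riley_poly (x y z : Cplx) : Cplx :=
  let t := fricke x y z in
  z * (t - C1) + (x * y - z) * (C1 + t - t ^ 2).

Lemma Mbracket_Wmat (X Y : Mat2) :
  let x := Mtr X in
  let y := Mtr Y in
  let z := Mtr (X * Y) in
  Mdet X = C1 -> Mdet Y = C1 ->
  (Mbracket X (Wmat X Y) = (fricke x y z * riley_poly x y z) *: Mbracket X Y)%M.
Proof.
  intros x y z detX detY; rewrite Wmat_palindromes by easy.
  rewrite Mbracket_addr, Mbracket_subr, !Mbracket_scalr.
  rewrite Mbracket_palindrome, Mbracket_palindrome_sum by easy.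
  rewrite Mbracket_adjr, Mbracket_self.
  fold x y z; unfold riley_poly; set (t := fricke x y z); Mat2_ring.
Qed.

Lemma Mcommutator_Wmat_eq1 (X Y : Mat2) :
  Mdet X = C1 -> Mdet Y = C1 -> riley_poly (Mtr X) (Mtr Y) (Mtr (X * Y)) = C0 ->
  Mcommutator X (Wmat X Y) = MI.
Proof.
  intros detX detY riley_poly0.
  apply Mcommutator_eq1; [easy | now apply Mdet_Wmat |].
  rewrite Mbracket_Wmat, riley_poly0 by easy; Mat2_ring.
Qed.

Lemma riley_poly_RMpoly (V c s : Cplx) (A : R) :
  c = #A * s -> c ^ 2 + s ^ 2 = C1 ->
  riley_poly (#2 * c) (#2 * c) (#2 * (c ^ 2 - s ^ 2 * V))
  = #(-4) * s ^ 10 * RMpoly V A.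
Proof.
  intros -> cos2_sin2.
  assert (A2s2 : #A ^ 2 * s ^ 2 = C1 - s ^ 2)
    by (transitivity ((#A * s) ^ 2); [|rewrite <- cos2_sin2]; ring).
  (* [A] has degree 8 in [RMpoly], so [s ^ 10] turns its powers into [A * s]. *)
  unfold riley_poly, fricke, RMpoly; ring [A2s2].
Qed.

Lemma Mdet_Smat (alpha : R) (rho : Cplx) : Mdet (Smat alpha rho) = C1.
Proof.
  rewrite <- (RtoC_cos2_sin2 (alpha / 2)).
  unfold Mdet, Smat; cbn [m11 m12 m21 m22].
  ring [Ci_sqr (Cexp_mul_opp (#(/2) * rho))].
Qed.

Lemma Tmat_Smat (alpha : R) (rho : Cplx) : Tmat alpha rho = Smat alpha (- rho).
Proof.
  unfold Tmat, Smat.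
  replace (#(/2) * - rho) with (- (#(/2) * rho)) by ring.
  now replace (- - (#(/2) * rho)) with (#(/2) * rho) by ring.
Qed.

Lemma Mdet_Tmat (alpha : R) (rho : Cplx) : Mdet (Tmat alpha rho) = C1.
Proof. rewrite Tmat_Smat; apply Mdet_Smat. Qed.

Lemma Mtr_Smat (alpha : R) (rho : Cplx) :
  Mtr (Smat alpha rho) = #2 * #(cos (alpha / 2)).
Proof. unfold Mtr, Smat; cbn [m11 m22]; ring. Qed.

Lemma Mtr_Tmat (alpha : R) (rho : Cplx) :
  Mtr (Tmat alpha rho) = #2 * #(cos (alpha / 2)).
Proof. rewrite Tmat_Smat; apply Mtr_Smat. Qed.

Lemma Mtr_Smat_Tmat (alpha : R) (rho : Cplx) :
  Mtr (Smat alpha rho * Tmat alpha rho)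
  = #2 * (#(cos (alpha / 2)) ^ 2 - #(sin (alpha / 2)) ^ 2 * Ccosh rho).
Proof.
  transitivity (#2 * #(cos (alpha / 2)) ^ 2
                - #(sin (alpha / 2)) ^ 2 * (#2 * Ccosh rho)); [|ring].
  rewrite Ccosh_half; unfold Mtr, Smat, Tmat; cbn [m11 m12 m21 m22 Mmul].
  ring [Ci_sqr].
Qed.

Theorem theorem3p2 (alpha : R) (rho : Cplx) :
  0 < alpha < 2 * PI ->
  RMpoly (Ccosh rho) (cos (alpha / 2) / sin (alpha / 2)) = C0 ->
  let S := Smat alpha rho in
  let T := Tmat alpha rho in
  let W := Wmat S T in
  Mmul S (Mmul W (Mmul (Minv S) (Minv W))) = MI.
Proof.
  intros alpha_bounds RMpoly0 S T W.
  assert (sin_neq0 : sin (alpha / 2) <> 0%R)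
    by (apply Rgt_not_eq, sin_gt_0; lra).
  apply Mcommutator_Wmat_eq1; [apply Mdet_Smat | apply Mdet_Tmat |].
  unfold S, T; rewrite Mtr_Smat, Mtr_Tmat, Mtr_Smat_Tmat.
  rewrite (riley_poly_RMpoly _ _ _ (cos (alpha / 2) / sin (alpha / 2))).
  rewrite RMpoly0.
  - ring.
  - apply Cplx_ext; simpl; now field.
  - apply RtoC_cos2_sin2.
Qed.
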